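(* Let $(\mathcal A,\mathfrak g,h)$ be a (left) hermitian calculus such that $\Omega^1_{\mathfrak g}$ is a finitely generated free left $\mathcal A$-module with $\dim(\mathfrak g)=\operatorname{rk}(\Omega^1_{\mathfrak g})=n$. Assume that there exist a basis $\{\theta^i\}_{i=1}^n$ of $\Omega^1_{\mathfrak g}$ and a basis $\{\partial_a\}_{a=1}^n$ of $\mathfrak g$ (over $\mathbb C$) such that $\theta^i(\partial_a)=\delta^i_a 1$ for $i,a=1,\dots,n$. Then there exists a Levi-Civita connection on $\Omega^1_{\mathfrak g}$ with respect to $h$ if and only if $(\mathcal A,\mathfrak g,h)$ is weakly symmetric.
   Context: Setting. $\mathcal A$ is a unital associative $*$-algebra over $\mathbb C$ with center $Z(\mathcal A)$ and unit $1$. $\mathrm{Der}(\mathcal A)$ is the complex Lie algebra of derivations of $\mathcal A$, with $(z\partial)(a)=z\,\partial(a)$ for $z\in Z(\mathcal A)$ and $\partial^*(a)=\partial(a^* )^*$. $\mathfrak g\subseteq\mathrm{Der}(\mathcal A)$ is a complex Lie subalgebra closed under $*$ (not necessarily a $Z(\mathcal A)$-submodule). Forms. $\bar\Omega^k_{\mathfrak g}$ is the set of alternating multiadditive maps $\omega:\mathfrak g^k\to\mathcal A$ such that $\omega(z\partial,\partial_2,\dots,\partial_k)=z\,\omega(\partial,\partial_2,\dots,\partial_k)$ whenever $z\in Z(\mathcal A)$, $\partial\in\mathfrak g$ and $z\partial\in\mathfrak g$; $\bar\Omega^0_{\mathfrak g}=\mathcal A$. It is an $\mathcal A$-bimodule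 by $(a\omega b)(\cdot)=a\,\omega(\cdot)\,b$. The exterior derivative is $da(\partial)=\partial(a)$ for $a\in\mathcal A$ and, for $\omega\in\bar\Omega^k_{\mathfrak g}$, $k\ge1$, $$d\omega(\partial_0,\dots,\partial_k)=\sum_{i}(-1)^i\partial_i\big(\omega(\partial_0,\dots,\hat\partial_i,\dots,\partial_k)\big)+\sum_{i<j}(-1)^{i+j}\omega([\partial_i,\partial_j],\partial_0,\dots,\hat\partial_i,\dots,\hat\partial_j,\dots,\partial_k).$$ $\Omega^1_{\mathfrak g}\subseteq\bar\Omega^1_{\mathfrak g}$ is the sub-bimodule of finite sums of elements $a_0\,da_1$, $a_0,a_1\in\mathcal A$. Connections. A left $\mathfrak g$-connection on a left $\mathcal A$-module $M$ is a map $\nabla:M\times\mathfrak g\to M$, $(m,\partial)\mapsto\nabla_\partial m$, additive in both arguments, with $\nabla_\partial(am)=a\nabla_\partial m+(\partial a)m$ for $a\in\mathcal A$, and $\nabla_{z\partial}m=z\nabla_\partial m$ for $z\in Z(\mathcal A)$ with $z\partial\in\mathfrak g$. $(\mathcal A,\mathfrak g)$ is a (left) derivation based calculus if there exists a left $\mathfrak g$-connection on $\Omega^1_{\mathfrak g}$. Hermitian forms. A left hermitian form on a left $\mathcal A$-module $M$ is a map $h:M\times M\to\mathcal A$, additive in the first argument, with $h(am_1,m_2)=a\,h(m_1,m_2)$ and $h(m_1,m_2)^*=h(m_2,m_1)$. Let $M^*$ be the dual of the left module $M$ (left $\mathcal A$-linear maps $M\to\mathcal A$), a right module by $(\phi a)(m)=\phi(m)a$.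 $h$ is invertible if $\hat h:M\to M^*$, $\hat h(m_1)(m_2)=h(m_2,m_1)$, is a bijection; then $h^{-1}:M^*\times M^*\to\mathcal A$ is defined by $h^{-1}(\phi_1,\phi_2)=h(\hat h^{-1}(\phi_1),\hat h^{-1}(\phi_2))$. A (left) hermitian calculus is a triple $(\mathcal A,\mathfrak g,h)$ with $(\mathcal A,\mathfrak g)$ a (left) derivation based calculus and $h$ an invertible left hermitian form on $\Omega^1_{\mathfrak g}$. Symmetry form. For $\partial\in\mathfrak g$ let $\varphi(\partial)\in(\Omega^1_{\mathfrak g})^*$ be $\varphi(\partial)(\omega)=\omega(\partial)$. The symmetry form $\rho\in\bar\Omega^2_{\mathfrak g}$ is $\rho(\partial_1,\partial_2)=h^{-1}(\varphi(\partial_1^* ),\varphi(\partial_2))-h^{-1}(\varphi(\partial_2^* ),\varphi(\partial_1))$. The calculus is weakly symmetric if $d\rho=0$. Levi-Civita. A connection $\nabla$ on $\Omega^1_{\mathfrak g}$ is torsion free if $(\nabla_{\partial_1}\omega)(\partial_2)-(\nabla_{\partial_2}\omega)(\partial_1)=d\omega(\partial_1,\partial_2)$ for all $\omega\in\Omega^1_{\mathfrak g}$, $\partial_1,\partial_2\in\mathfrak g$; it is compatible with $h$ if $\partial h(\omega,\eta)=h(\nabla_\partial\omega,\eta)+h(\omega,\nabla_{\partial^*}\eta)$ for all $\omega,\eta\in\Omega^1_{\mathfrak g}$, $\partial\in\mathfrak g$. It is a Levi-Civita connection with respect to $h$ if it is torsion free and compatible with $h$. *)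

(* Defs.v *)
From HB Require Import structures.
From mathcomp Require Import all_boot all_order all_algebra complex.
From mathcomp Require Import boolp classical_sets functions reals.

Set Implicit Arguments.
Unset Strict Implicit.
Unset Printing Implicit Defensive.

Import GRing.Theory Num.Theory.
Local Open Scope ring_scope.

(* [algType] consists of nontrivial algebras, so A is not the zero algebra. *)
HB.mixin Record isStarAlgebra (C : numClosedFieldType) A
    of GRing.Algebra C A := {
  star : A -> A;
  starK : forall a, star (star a) = a;
  starD : forall a b, star (a + b) = star a + star b;
  starZ : forall (c : C) a, star (c *: a) = Num.conj c *: star a;
  starM : forall a b, star (a * b) = star b * star a;
}.

#[short(type="starAlgType")]
HB.structure Definition StarAlgebra (C : numClosedFieldType) :=
  {A of GRing.Algebra C A & isStarAlgebra C A}.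

Section Basis.
Variables (R : pzRingType) (M : lmodType R).

Definition is_basis n (e : 'I_n -> M) : Prop :=
  (forall m, exists c : 'I_n -> R, m = \sum_(i < n) c i *: e i) /\
  (forall c : 'I_n -> R, \sum_(i < n) c i *: e i = 0 -> forall i, c i = 0).

Definition free_of_rank n : Prop := exists e : 'I_n -> M, is_basis e.

End Basis.

Section Derivations.
Variables (C : numClosedFieldType) (A : starAlgType C).

Definition central (z : A) : Prop := forall a, z * a = a * z.

Definition derivation_axiom (f : A -> A) : Prop :=
  (forall (c : C) a b, f (c *: a + b) = c *: f a + f b) /\
  (forall a b, f (a * b) = f a * b + a * f b).

Definition is_derivation : {pred A -> A} := fun f => `[< derivation_axiom f >].

Record der := Der { der_fun :> A -> A; der_funP : der_fun \in is_derivation }.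

Lemma derP (X : der) : derivation_axiom X.
Proof. exact/asboolP/der_funP. Qed.

Lemma derD (X : der) a b : X (a + b) = X a + X b.
Proof. by have [L _] := derP X; rewrite -[a in LHS]scale1r L scale1r. Qed.

Lemma der0 (X : der) : X 0 = 0.
Proof. by apply: (addrI (X 0)); rewrite -derD !addr0. Qed.

Lemma derZ (X : der) (c : C) a : X (c *: a) = c *: X a.
Proof. by have [L _] := derP X; rewrite -[_ *: a]addr0 L der0 addr0. Qed.

Lemma derN (X : der) a : X (- a) = - X a.
Proof. by rewrite -scaleN1r derZ scaleN1r. Qed.

Lemma derM (X : der) a b : X (a * b) = X a * b + a * X b.
Proof. by case: (derP X) => _; exact. Qed.

Lemma der_inj (X Y : der) : (forall a, X a = Y a) -> X = Y.
Proof.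
case: X Y => [f fP] [g gP] /= /funext fg; case: _ / fg in gP *.
by rewrite (bool_irrelevance fP gP).
Qed.

Lemma is_derivation_submod : submod_closed is_derivation.
Proof.
have fE (c : C) (f g : A -> A) a : (c *: f + g) a = c *: f a + g a by [].
have f0 a : (0 : A -> A) a = 0 by [].
split=> [|c f g /asboolP[Lf Mf] /asboolP[Lg Mg]]; apply/asboolP; split.
- by move=> c a b; rewrite !f0 scaler0 addr0.
- by move=> a b; rewrite !f0 mul0r mulr0 addr0.
- move=> k a b; rewrite !fE Lf Lg !scalerDr !scalerA mulrC -!addrA.
  by congr (_ + _); rewrite addrCA.
- move=> a b; rewrite !fE Mf Mg scalerDr mulrDl mulrDr scalerAl scalerAr.
  by rewrite addrACA.
Qed.

HB.instance Definition _ :=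
  GRing.isSubmodClosed.Build C (A -> A) is_derivation is_derivation_submod.
HB.instance Definition _ := [isSub for der_fun].
HB.instance Definition _ := [Choice of der by <:].
HB.instance Definition _ := [SubChoice_isSubLmodule of der by <:].

Lemma lie_subproof (X Y : der) :
  (fun a => X (Y a) - Y (X a)) \in is_derivation.
Proof.
apply/asboolP; split=> [c a b|a b].
  by rewrite !(derD, derZ) scalerBr addrACA -opprD.
have E (p q r s u v : A) :
    (p + u + (v + q)) - (r + v + (u + s)) = p - r + (q - s).
  rewrite (addrC v q) (addrC u s) addrACA [r + v + _]addrACA (addrC v u).
  by rewrite [r + s + _]addrC addrKA opprD addrACA.
by rewrite !derM !derD !derM E mulrBl mulrBr.
Qed.

Definition lie (X Y : der) : der := Der (lie_subproof X Y).

Lemma der_star_subproof (X : der) :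
  (fun a => star (X (star a))) \in is_derivation.
Proof.
apply/asboolP; split=> [c a b|a b].
  by rewrite starD starZ derD derZ starD starZ conjCK.
by rewrite starM derM starD !starM !starK addrC.
Qed.

Definition der_star (X : der) : der := Der (der_star_subproof X).

Record star_lie_subalg := StarLieSubalg {
  sla_pred :> {pred der};
  sla_submod : submod_closed sla_pred;
  sla_lie : forall X Y, X \in sla_pred -> Y \in sla_pred ->
    lie X Y \in sla_pred;
  sla_star : forall X, X \in sla_pred -> der_star X \in sla_pred }.

HB.instance Definition _ (g : star_lie_subalg) :=
  GRing.isSubmodClosed.Build C der (sla_pred g) (sla_submod g).

Record sla_elt (g : star_lie_subalg) :=
  SlaElt { sla_der :> der; sla_derP : sla_der \in sla_pred g }.

HB.instance Definition _ g := [isSub for @sla_der g].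
HB.instance Definition _ g := [Choice of sla_elt g by <:].
HB.instance Definition _ g := [SubChoice_isSubLmodule of sla_elt g by <:].

End Derivations.

Section Forms.
Variables (C : numClosedFieldType) (A : starAlgType C).
Variable g : star_lie_subalg A.
Local Notation gT := (sla_elt g).

Definition gbracket (X Y : gT) : gT :=
  SlaElt (sla_lie (sla_derP X) (sla_derP Y)).

Definition gstar (X : gT) : gT := SlaElt (sla_star (sla_derP X)).

(* [Y] is the derivation [z X]; since [X] and [Y] range over [g], this
   quantifies over exactly the [X] in [g] such that [z X] lies in [g]. *)
Definition is_zscale (z : A) (X Y : gT) : Prop := forall a, Y a = z * X a.

Lemma gt_ext (X Y : gT) : (forall a, X a = Y a) -> X = Y.
Proof. by move=> H; apply: val_inj; apply: der_inj. Qed.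

Lemma gstarD (X Y : gT) : gstar (X + Y) = gstar X + gstar Y.
Proof. by apply: gt_ext => a; rewrite /= starD. Qed.

(* Arbitrary maps from g^k to A; the exterior derivative is defined on all of
   them, and [is_form] singles out the forms.  [A^o] is [A] as a left
   [A]-module, so that [cochain k] is a left [A]-module. *)
Definition cochain k : Type := k.-tuple gT -> A^o.

HB.instance Definition _ k :=
  GRing.Lmodule.copy (cochain k) (k.-tuple gT -> A^o).

Definition set_slot k (i : 'I_k) (X : gT) (t : k.-tuple gT) : k.-tuple gT :=
  [tuple if l == i then X else tnth t l | l < k].

Definition is_form k (w : cochain k) : Prop :=
  [/\ forall (i : 'I_k) X Y t,
        w (set_slot i (X + Y) t) = w (set_slot i X t) + w (set_slot i Y t),
      forall t (i j : 'I_k), i != j -> tnth t i = tnth t j -> w t = 0 &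
      forall (i : 'I_k) z X Y t, i = 0%N :> nat -> central z ->
        is_zscale z X Y -> w (set_slot i Y t) = z * w (set_slot i X t)].

(* For i < j, the tuple l |-> lift j (lift (inord i) l) enumerates the indices other
   than i and j in increasing order. *)
Definition dext k : cochain k -> cochain k.+1 :=
  match k with
  | 0 => fun w t => tnth t ord0 (w [tuple])
  | k'.+1 => fun w t =>
      \sum_(i < k'.+2) (-1) ^+ i *
        tnth t i (w [tuple tnth t (lift i l) | l < k'.+1])
      + \sum_(i < k'.+2) \sum_(j < k'.+2 | (i < j)%N) (-1) ^+ (i + j) *
        w [tuple of gbracket (tnth t i) (tnth t j) ::
             [tuple tnth t (lift j (lift (inord i) l)) | l < k']]
  end.

Lemma tuple1_eq (T : Type) (u v : 1.-tuple T) : thead u = thead v -> u = v.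
Proof. by move=> H; apply: eq_from_tnth => i; rewrite ord1. Qed.

Lemma tuple2_eq (T : Type) (u v : 2.-tuple T) : thead u = thead v ->
  tnth u (lift ord0 ord0) = tnth v (lift ord0 ord0) -> u = v.
Proof.
move=> H K; apply: eq_from_tnth => i.
by case: (unliftP ord0 i) => [j|] -> //; rewrite ord1.
Qed.

Lemma dext1E (w : cochain 1) X Y :
  dext w [tuple X; Y]
    = X (w [tuple Y]) - Y (w [tuple X]) - w [tuple gbracket X Y].
Proof.
rewrite /dext !big_ord_recl !big_ord0 /= !(big_mkcond (fun j => _ < _)%N) /=.
rewrite !big_ord_recl !big_ord0 /= !addr0 !add0r !expr1 !mul1r !mulN1r.
congr (der_fun _ (w _) - der_fun _ (w _) - w _); apply: tuple1_eq => //.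
all: by rewrite /thead tnth_mktuple.
Qed.

Lemma dext2E (w : cochain 2) X Y Z :
  dext w [tuple X; Y; Z]
    = X (w [tuple Y; Z]) - Y (w [tuple X; Z]) + Z (w [tuple X; Y])
      - w [tuple gbracket X Y; Z] + w [tuple gbracket X Z; Y]
      - w [tuple gbracket Y Z; X].
Proof.
rewrite /dext !big_ord_recl !big_ord0 /= !(big_mkcond (fun j => _ < _)%N) /=.
rewrite !big_ord_recl !big_ord0 /= !addr0 !add0r !addrA.
rewrite ?expr1 ?expr0 -![_ ^+ (bump _ _ + bump _ _)%N]signr_odd /= ?expr0.
rewrite -?[_ ^+ (bump _ _)]signr_odd /= ?expr0 ?expr1 ?mulN1r ?mul1r.
have E T (x : T) (f : 'I_1 -> T) :
    nth x [seq f l | l <- enum 'I_1] (0 + 0) = f ord0.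
  by rewrite enum_ordSl.
congr (der_fun _ (w _) - der_fun _ (w _) + der_fun _ (w _) - w _ + w _ - w _);
  apply: tuple2_eq; rewrite /thead ?tnth_mktuple // !(tnth_nth X) /= E;
  by rewrite (tnth_nth X) /= /bump /= ?inordK.
Qed.

Definition d0 (a : A) : cochain 1 := dext ((fun=> a) : cochain 0).

Definition in_Omega1 : {pred cochain 1} := fun w =>
  `[< exists s : seq (A * A), w = \sum_(p <- s) p.1 *: d0 p.2 >].

Record Omega1 := MkOmega1 {
  Omega1_val :> 1.-tuple gT -> A^o; Omega1_valP : Omega1_val \in in_Omega1 }.

Lemma in_Omega1_submod : submod_closed in_Omega1.
Proof.
split=> [|a _ _ /asboolP[s ->] /asboolP[r ->]]; apply/asboolP.
  by exists [::]; rewrite big_nil.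
exists ([seq (a * p.1, p.2) | p <- s] ++ r).
rewrite big_cat big_map scaler_sumr; congr (_ + _).
by apply: eq_bigr => p _; rewrite scalerA.
Qed.

HB.instance Definition _ :=
  GRing.isSubmodClosed.Build A (cochain 1) in_Omega1 in_Omega1_submod.
HB.instance Definition _ := [isSub of Omega1 for Omega1_val].
HB.instance Definition _ := [Choice of Omega1 by <:].
HB.instance Definition _ := [SubChoice_isSubLmodule of Omega1 by <:].

Lemma Omega1_form (w : Omega1) : is_form (w : cochain 1).
Proof.
case: w => /= w /asboolP[s ->].
have E (t : 1.-tuple gT) : (\sum_(p <- s) p.1 *: (d0 p.2 : cochain 1)) t
    = \sum_(p <- s) p.1 * thead t p.2.
  elim: s => [|p s IH]; first by rewrite !big_nil.
  by rewrite !big_cons -IH.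
split=> [i X Y t|t i j|i z X Y t _ zc XY]; last 2 first.
- by rewrite !ord1.
- rewrite !E mulr_sumr; apply: eq_bigr => p _.
  by rewrite /thead !tnth_mktuple !ord1 /= XY !mulrA zc.
rewrite !E -big_split; apply: eq_bigr => p _.
by rewrite /thead !tnth_mktuple !ord1 /= -mulrDr.
Qed.

Lemma Omega1D (w : Omega1) X Y :
  w [tuple X + Y] = w [tuple X] + w [tuple Y].
Proof.
have [+ _ _] := Omega1_form w; move=> /(_ ord0 X Y [tuple X]).
by congr (_ = _ + _); congr (Omega1_val w _); apply: tuple1_eq;
  rewrite /thead tnth_mktuple.
Qed.

Lemma Omega1Z (w : Omega1) z X Y : central z -> is_zscale z X Y ->
  w [tuple Y] = z * w [tuple X].
Proof.
have [_ _ +] := Omega1_form w; move=> /(_ ord0 z X Y [tuple X] erefl) + zc XY.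
move=> /(_ zc XY).
by congr (_ = _ * _); congr (Omega1_val w _); apply: tuple1_eq;
  rewrite /thead tnth_mktuple.
Qed.

End Forms.

Section Connections.
Variables (C : numClosedFieldType) (A : starAlgType C).
Variable g : star_lie_subalg A.
Local Notation gT := (sla_elt g).

Record is_connection (M : lmodType A) (nabla : M -> gT -> M) : Prop :=
  IsConnection {
    connDl : forall m1 m2 X, nabla (m1 + m2) X = nabla m1 X + nabla m2 X;
    connDr : forall m X Y, nabla m (X + Y) = nabla m X + nabla m Y;
    connM : forall a m X, nabla (a *: m) X = a *: nabla m X + X a *: m;
    connZ : forall z X Y, central z -> is_zscale z X Y ->
      forall m, nabla m Y = z *: nabla m X }.

Definition derivation_based_calculus : Prop :=
  exists nabla : Omega1 g -> gT -> Omega1 g, is_connection nabla.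

Definition torsion_free (nabla : Omega1 g -> gT -> Omega1 g) : Prop :=
  forall (w : Omega1 g) (X Y : gT),
    nabla w X [tuple Y] - nabla w Y [tuple X]
      = dext (w : cochain g 1) [tuple X; Y].

End Connections.

Section Hermitian.
Variables (C : numClosedFieldType) (A : starAlgType C).

Record hermitian_form (M : lmodType A) := HermitianForm {
  hform :> M -> M -> A;
  hformDl : forall m1 m2 m, hform (m1 + m2) m = hform m1 m + hform m2 m;
  hformZl : forall a m1 m2, hform (a *: m1) m2 = a * hform m1 m2;
  hform_star : forall m1 m2, star (hform m1 m2) = hform m2 m1 }.

Variable M : lmodType A.

Lemma scalar_ext (f k : {scalar M}) :
  (forall m, f m = k m) -> f = k.
Proof.
case: f k => [f [[fa] [fs]]] [k [[ka] [ks]]] /= /funext fk.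
case: _ / fk in ka ks *.
by rewrite (Prop_irrelevance fa ka) (Prop_irrelevance fs ks).
Qed.

(* The dual of [M] is [{scalar M}], the left [A]-linear maps M -> A. *)
Definition hhat_fun (h : hermitian_form M) (m1 : M) : M -> A :=
  fun m2 => h m2 m1.

Lemma hhat_fun_scalar h m1 : scalar (hhat_fun h m1).
Proof. by move=> a m n; rewrite /hhat_fun hformDl hformZl. Qed.

HB.instance Definition _ h m1 :=
  GRing.isLinear.Build A M A *%R (hhat_fun h m1) (hhat_fun_scalar h m1).

Definition hhat (h : hermitian_form M) (m1 : M) : {scalar M} := hhat_fun h m1.

Definition invertible (h : hermitian_form M) : Prop := bijective (hhat h).

(* The inverse of [hhat h] when [h] is invertible. *)
Definition hhat_inv (h : hermitian_form M) (phi : {scalar M}) : M :=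
  xget 0 [set m | hhat h m = phi]%classic.

Lemma hhatK h : invertible h -> cancel (hhat_inv h) (hhat h).
Proof.
move=> [k hk kh] phi; rewrite /hhat_inv; case: xgetP => [m _ //|].
by move=> /(_ (k phi)) []; exact: kh.
Qed.

Lemma hhat_invK h : invertible h -> cancel (hhat h) (hhat_inv h).
Proof. by move=> hi m; apply: (bij_inj hi); rewrite hhatK. Qed.

Definition hform_inv (h : hermitian_form M) (phi1 phi2 : {scalar M}) : A :=
  h (hhat_inv h phi1) (hhat_inv h phi2).

Lemma hform_invl (h : hermitian_form M) (f k : {scalar M}) :
  invertible h -> hform_inv h f k = k (hhat_inv h f).
Proof. by move=> hi; rewrite -[in RHS](hhatK hi k). Qed.

Lemma hform_invr (h : hermitian_form M) (f k : {scalar M}) :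
  invertible h -> hform_inv h f k = star (f (hhat_inv h k)).
Proof. by move=> hi; rewrite -[f in RHS](hhatK hi f) hform_star. Qed.

End Hermitian.

Section LeviCivita.
Variables (C : numClosedFieldType) (A : starAlgType C).
Variable g : star_lie_subalg A.
Local Notation gT := (sla_elt g).

Definition hermitian_calculus (h : hermitian_form (Omega1 g)) : Prop :=
  derivation_based_calculus g /\ invertible h.

Definition phi_fun (X : gT) : Omega1 g -> A := fun w => w [tuple X].

Lemma phi_fun_scalar X : scalar (phi_fun X).
Proof. by []. Qed.

HB.instance Definition _ X :=
  GRing.isLinear.Build A (Omega1 g) A *%R (phi_fun X) (phi_fun_scalar X).

Definition phi (X : gT) : {scalar Omega1 g} := phi_fun X.

Definition rho (h : hermitian_form (Omega1 g)) : cochain g 2 := fun t =>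
  let X := tnth t ord0 in let Y := tnth t ord_max in
  hform_inv h (phi (gstar X)) (phi Y) - hform_inv h (phi (gstar Y)) (phi X).

Lemma rho_form (h : hermitian_form (Omega1 g)) :
  invertible h -> is_form (rho h).
Proof.
move=> hi.
have D X Y k : hform_inv h (phi (gstar (X + Y))) k =
    hform_inv h (phi (gstar X)) k + hform_inv h (phi (gstar Y)) k.
  by rewrite !hform_invr // gstarD -starD; congr star; exact: Omega1D.
have D' X Y k : hform_inv h k (phi (X + Y)) =
    hform_inv h k (phi X) + hform_inv h k (phi Y).
  by rewrite !hform_invl //; exact: Omega1D.
have I2 (P : 'I_2 -> Prop) : P ord0 -> P ord_max -> forall i, P i.
  move=> P0 P1 i; case: (unliftP ord0 i) => [j|] -> //; rewrite ord1.
  by have -> : lift ord0 ord0 = ord_max :> 'I_2 by apply: val_inj.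
split.
- apply: I2 => X Y t; rewrite /rho !tnth_mktuple /=.
    by rewrite D D' opprD addrACA.
  by rewrite D D' opprD addrACA.
- move=> t i j ij tij; suff E : tnth t ord0 = tnth t ord_max.
    by rewrite /rho E subrr.
  move: i j ij tij; apply: (I2); apply: (I2) => //.
- move=> i z X Y t i0 zc XY; have -> : i = ord0 by apply: val_inj.
  rewrite /rho !tnth_mktuple /= mulrBr; congr (_ - _); last first.
    by rewrite !hform_invl //; exact: Omega1Z.
  rewrite !hform_invr // -[z in RHS]starK -starM.
  have sc : central (star z).
    by move=> a; rewrite -[a in LHS]starK -[a in RHS]starK -!starM zc.
  rewrite -sc; congr star.
  apply: Omega1Z => // a.
  by rewrite /= XY starM sc.
Qed.

Definition weakly_symmetric (h : hermitian_form (Omega1 g)) : Prop :=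
  dext (rho h) = 0.

Definition compatible (h : hermitian_form (Omega1 g))
    (nabla : Omega1 g -> gT -> Omega1 g) : Prop :=
  forall (w eta : Omega1 g) (X : gT),
    X (h w eta) = h (nabla w X) eta + h w (nabla eta (gstar X)).

Definition levi_civita (h : hermitian_form (Omega1 g))
    (nabla : Omega1 g -> gT -> Omega1 g) : Prop :=
  [/\ is_connection nabla, torsion_free nabla & compatible h nabla].

End LeviCivita.

(* Main.v *)
Require Import Defs.
From mathcomp Require Import all_boot all_order all_algebra complex reals.
From mathcomp Require Import boolp.

Set Implicit Arguments.
Unset Strict Implicit.
Unset Printing Implicit Defensive.

Import GRing.Theory Num.Theory.
Local Open Scope ring_scope.

(* Let E_X be the form representing evaluation at X, h(w, E_X) = w(X), and put
   G(X, Y) = E_{X^*}(Y), so that rho is the antisymmetrization of G.  Writing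
   T(X, Y, Z) = (nabla_X E_{Y^*})(Z), torsion freeness prescribes
   T(X, Y, Z) - T(Z, Y, X), and metric compatibility says that T is fixed by
   the involution T |-> X G(Y, Z) - T(X^*, Z^*, Y^* )^*.  Together they give
   T(X, Y, Z) - T(Y, X, Z) = G([X, Y], Z).  The two difference equations form
   a hexagon over the permutations of (X, Y, Z), which closes up exactly when
   d rho = 0.  Conversely, if the hexagon closes, averaging over permutations
   solves the two difference equations, averaging over the involution makes
   the solution metric, and the dual frame turns it into a connection. *)

(** * Linear identities in abelian groups, by reflection *)

Section ZmodReflection.
Variable V : zmodType.

Inductive zexpr :=
  ZVar of nat | ZZero | ZOpp of zexpr | ZAdd of zexpr & zexpr
| ZMuln of zexpr & nat.

Fixpoint zeval (env : seq V) e : V :=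
  match e with
  | ZVar i => env`_i
  | ZZero => 0
  | ZOpp e => - zeval env e
  | ZAdd e f => zeval env e + zeval env f
  | ZMuln e n => zeval env e *+ n
  end.

Fixpoint zcoef e (i : nat) : int :=
  match e with
  | ZVar j => (j == i)%:Z
  | ZZero => 0
  | ZOpp e => - zcoef e i
  | ZAdd e f => zcoef e i + zcoef f i
  | ZMuln e n => zcoef e i *+ n
  end.

Lemma zevalE env e :
  zeval env e = \sum_(i < size env) env`_i *~ zcoef e i.
Proof.
elim: e => [j||e IHe|e IHe f IHf|e IHe k] /=.
- have [lt|ge] := ltnP j (size env); last first.
    (* A variable beyond the environment reads the default 0, and no summation index matches it. *)
    rewrite nth_default // big1 // => i _.
    by rewrite gtn_eqF ?mulr0z // (leq_trans _ ge).
  rewrite (bigD1 (Ordinal lt)) //= eqxx mulr1z big1 ?addr0 // => i /negPf ni.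
  by rewrite eq_sym [_ == _]ni mulr0z.
- by rewrite big1 // => i _; rewrite mulr0z.
- by rewrite IHe -sumrN; apply: eq_bigr => i _; rewrite mulrNz.
- by rewrite IHe IHf -big_split; apply: eq_bigr => i _; rewrite mulrzDr.
- by rewrite IHe -sumrMnl; apply: eq_bigr => i _;
  rewrite -[in RHS]mulr_natr natz mulrzA pmulrn.
Qed.

Lemma zeval_eq env e f :
  all (fun i => zcoef e i == zcoef f i) (iota 0 (size env)) ->
  zeval env e = zeval env f.
Proof.
move=> /allP H; rewrite !zevalE; apply: eq_bigr => i _.
by congr (_ *~ _); apply/eqP/H; rewrite mem_iota /=.
Qed.

End ZmodReflection.

(** Turns a goal that follows from one known equation into an unconditional identity, which [zmod]
    can decide. *)
Lemma eq_of_sub (V : zmodType) (a b c d : V) : a = b -> c - d = a - b -> c = d.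
Proof. by move=> -> /eqP; rewrite subrr subr_eq0 => /eqP. Qed.

Ltac zatoms acc t :=
  lazymatch t with
  | @GRing.add _ ?a ?b => let acc := zatoms acc a in zatoms acc b
  | @GRing.opp _ ?a => zatoms acc a
  | @GRing.natmul _ ?a _ => zatoms acc a
  | @GRing.zero _ => acc
  | _ =>
    let rec mem l := lazymatch l with
      | ?x :: ?l' => match l with
        | _ => let _ := match goal with _ => unify x t end in acc
        | _ => mem l'
        end
      | _ => constr:(t :: acc)
      end in mem acc
  end.

Ltac zreify env t :=
  lazymatch t with
  | @GRing.add _ ?a ?b =>
    let a := zreify env a in let b := zreify env b in constr:(ZAdd a b)
  | @GRing.opp _ ?a => let a := zreify env a in constr:(ZOpp a)
  | @GRing.natmul _ ?a ?n => let a := zreify env a in constr:(ZMuln a n)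
  | @GRing.zero _ => constr:(ZZero)
  | _ =>
    let rec index l := lazymatch l with
      | ?x :: ?l' => match l with
        | _ => let _ := match goal with _ => unify x t end in constr:(0%N)
        | _ => let i := index l' in constr:(S i)
        end
      end in let i := index env in constr:(ZVar i)
  end.

(* Decides identities of zmodules with [nat] multiples.  Atoms are compared up
   to conversion because the values of forms have type [A^o]. *)
Ltac zmod :=
  lazymatch goal with
  | |- @eq ?T ?a ?b =>
    let env := zatoms (@nil T) a in let env := zatoms env b in
    let e := zreify env a in let f := zreify env b in
    exact: (@zeval_eq _ env e f)
  end.


(** * Star identities and complex linearity *)

Section StarCalculus.
Variables (C : numClosedFieldType) (A : starAlgType C).
Variable g : star_lie_subalg A.
Local Notation gT := (sla_elt g).

Lemma star0 : star (0 : A) = 0.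
Proof. by apply: (addrI (star (0 : A))); rewrite -starD !addr0. Qed.

Lemma starN (a : A) : star (- a) = - star a.
Proof. by apply: (addrI (star a)); rewrite -starD !subrr star0. Qed.

Lemma starB (a b : A) : star (a - b) = star a - star b.
Proof. by rewrite starD starN. Qed.

Lemma star1 : star (1 : A) = 1.
Proof. by have := starM (star (1 : A)) 1; rewrite mulr1 !starK mulr1. Qed.

Lemma gstarK (X : gT) : gstar (gstar X) = X.
Proof. by apply: gt_ext => a; rewrite /= !starK. Qed.

Lemma gstar_lin (c : C) (X Y : gT) :
  gstar (c *: X + Y) = Num.conj c *: gstar X + gstar Y.
Proof. by apply: gt_ext => a; rewrite /= starD starZ. Qed.

Lemma gstar_bracket (X Y : gT) :
  gstar (gbracket X Y) = gbracket (gstar X) (gstar Y).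
Proof. by apply: gt_ext => a; rewrite /= !starK starB. Qed.

Lemma gbracketC (X Y : gT) : gbracket X Y = - gbracket Y X.
Proof. by apply: gt_ext => a; rewrite /= opprB. Qed.

Lemma gbracket_linl (c : C) (X X' Y : gT) :
  gbracket (c *: X + X') Y = c *: gbracket X Y + gbracket X' Y.
Proof.
apply: gt_ext => a /=; rewrite derD derZ scalerBr opprD !addrA.
by congr (_ + _); rewrite addrAC.
Qed.

Lemma der_lin (c : C) (X Y : gT) (a : A) : (c *: X + Y) a = c *: X a + Y a.
Proof. by []. Qed.

Lemma star_der (X : gT) (a : A) : star (X a) = gstar X (star a).
Proof. by rewrite /= starK. Qed.

(** A complex number [c] acts through the central element [c%:A], so linearity over the center
    includes linearity over [C]. *)
Lemma Omega1_lin (w : Omega1 g) (c : C) X Y :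
  w [tuple c *: X + Y] = c *: (w [tuple X] : A) + w [tuple Y].
Proof.
rewrite Omega1D; congr (_ + _).
rewrite (@Omega1Z _ _ _ w c%:A X); first by rewrite mulr_algl.
- by move=> a; rewrite mulr_algl mulr_algr.
- by move=> a; rewrite mulr_algl.
Qed.

Lemma Omega1_addE (w v : Omega1 g) X :
  (w + v) [tuple X] = (w [tuple X] : A) + v [tuple X].
Proof. by []. Qed.

Lemma Omega1_scaleE (a : A) (w : Omega1 g) X :
  (a *: w) [tuple X] = a * (w [tuple X] : A).
Proof. by []. Qed.

Lemma Omega1_ext (w v : Omega1 g) :
  (forall X, w [tuple X] = v [tuple X]) -> w = v.
Proof.
move=> wv; apply: val_inj; apply: funext => t.
have -> : t = [tuple thead t] by apply: tuple1_eq.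
exact: wv.
Qed.

Definition clin (f : gT -> A) : Prop :=
  forall c X Y, f (c *: X + Y) = c *: f X + f Y.

Lemma clinD f X Y : clin f -> f (X + Y) = f X + f Y.
Proof. by move=> lf; rewrite -[X in LHS]scale1r lf scale1r. Qed.

Lemma clin0 f : clin f -> f 0 = 0.
Proof. by move=> lf; apply: (addrI (f 0)); rewrite -clinD // !addr0. Qed.

Lemma clinZ f c X : clin f -> f (c *: X) = c *: f X.
Proof. by move=> lf; rewrite -[c *: X]addr0 lf clin0 // addr0. Qed.

Lemma clin_sum f n (F : 'I_n -> gT) :
  clin f -> f (\sum_i F i) = \sum_i f (F i).
Proof.
move=> lf; apply: (big_morph f _ (clin0 lf)) => X Y; exact: clinD.
Qed.

Definition trilin (T : gT -> gT -> gT -> A) : Prop :=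
  [/\ forall Y Z, clin (fun X => T X Y Z),
      forall X Z, clin (fun Y => T X Y Z) &
      forall X Y, clin (T X Y)].

Lemma trilinD T U :
  trilin T -> trilin U -> trilin (fun X Y Z => T X Y Z + U X Y Z).
Proof.
by case=> T1 T2 T3 [U1 U2 U3]; split=> Y Z c X X' /=;
  rewrite ?(T1, U1, T2, U2, T3, U3) scalerDr addrACA.
Qed.

Lemma trilinZ c T : trilin T -> trilin (fun X Y Z => c *: T X Y Z).
Proof.
by case=> T1 T2 T3; split=> Y Z d X X' /=;
  rewrite ?(T1, T2, T3) scalerDr !scalerA mulrC.
Qed.

Lemma trilinN T : trilin T -> trilin (fun X Y Z => - T X Y Z).
Proof.
by case=> T1 T2 T3; split=> Y Z d X X' /=;
  rewrite ?(T1, T2, T3) opprD scalerN.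
Qed.

Lemma trilinMn k T : trilin T -> trilin (fun X Y Z => T X Y Z *+ k).
Proof.
by case=> T1 T2 T3; split=> Y Z d X X' /=;
  rewrite ?(T1, T2, T3) mulrnDl scalerMnr.
Qed.

Lemma trilin12 T : trilin T -> trilin (fun X Y Z => T Y X Z).
Proof. by case. Qed.

Lemma trilin13 T : trilin T -> trilin (fun X Y Z => T Z Y X).
Proof. by case. Qed.

Lemma trilin_star T :
  trilin T -> trilin (fun X Y Z => star (T (gstar X) (gstar Z) (gstar Y))).
Proof.
by case=> T1 T2 T3; split=> Y Z d X X' /=;
  rewrite gstar_lin ?(T1, T2, T3) starD starZ conjCK.
Qed.

End StarCalculus.

(** * The Gram form of [h] and the symbol equations *)

Section Gram.
Variables (C : numClosedFieldType) (A : starAlgType C).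
Variable g : star_lie_subalg A.
Local Notation gT := (sla_elt g).
Variable h : hermitian_form (Omega1 g).
Hypothesis hi : invertible h.

Lemma hform0l w : h 0 w = 0.
Proof. by apply: (addrI (h 0 w)); rewrite -hformDl !addr0. Qed.

Lemma hformDr w v u : h w (v + u) = h w v + h w u.
Proof. by rewrite -hform_star hformDl starD !hform_star. Qed.

Lemma hformZr a w v : h w (a *: v) = h w v * star a.
Proof. by rewrite -hform_star hformZl starM hform_star. Qed.

Lemma hform0r w : h w 0 = 0.
Proof. by rewrite -hform_star hform0l star0. Qed.

Lemma hform_injr w v : (forall u, h u w = h u v) -> w = v.
Proof. by move=> E; apply: (bij_inj hi); apply: scalar_ext => u; exact: E. Qed.

Definition riesz (X : gT) : Omega1 g := hhat_inv h (phi X).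

Lemma rieszE w X : h w (riesz X) = w [tuple X].
Proof.
by have := congr1 (fun f : {scalar Omega1 g} => f w) (hhatK hi (phi X)).
Qed.

(** This is h^{-1} at [phi (gstar X)] and [phi Y]; the star on [X] cancels the conjugate-linearity
    of [riesz]. *)
Definition gram (X Y : gT) : A := riesz (gstar X) [tuple Y].

Lemma gram_star X Y : star (gram X Y) = gram (gstar Y) (gstar X).
Proof. by rewrite /gram -!rieszE hform_star gstarK. Qed.

Lemma gram_linr X : clin (gram X).
Proof. by move=> c Y Z; exact: Omega1_lin. Qed.

Lemma gram_linl Y : clin (gram^~ Y).
Proof.
move=> c X Z; apply: (can_inj (@starK _ _)).
by rewrite starD starZ !gram_star gstar_lin gram_linr.
Qed.

Lemma gramN X Y : gram (- X) Y = - gram X Y.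
Proof. by rewrite -scaleN1r (clinZ _ _ (gram_linl Y)) scaleN1r. Qed.

Lemma gramNr X Y : gram X (- Y) = - gram X Y.
Proof. by rewrite -scaleN1r (clinZ _ _ (gram_linr X)) scaleN1r. Qed.

Lemma rhoE X Y : rho h [tuple X; Y] = gram X Y - gram Y X.
Proof. by rewrite /rho !hform_invl. Qed.

Definition bracket_form (X Y Z : gT) : A := gram (gbracket X Y) Z.

(** The exterior derivative of [riesz (gstar Y)] at [X] and [Z]. *)
Definition torsion_form (X Y Z : gT) : A :=
  X (gram Y Z) - Z (gram Y X) - gram Y (gbracket X Z).

Lemma bracket_formC X Y Z : bracket_form X Y Z = - bracket_form Y X Z.
Proof. by rewrite /bracket_form gbracketC gramN. Qed.

Lemma torsion_formC X Y Z : torsion_form X Y Z = - torsion_form Z Y X.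
Proof.
by rewrite /torsion_form (gbracketC X) gramNr; zmod.
Qed.

Lemma trilin_bracket_form : trilin bracket_form.
Proof.
have H Y Z : clin (fun X => bracket_form X Y Z).
  by move=> c X X'; rewrite /bracket_form gbracket_linl gram_linl.
split=> // [X Z c Y Y'|X Y c Z Z']; last exact: gram_linr.
by rewrite !(bracket_formC X) H opprD scalerN.
Qed.

Lemma trilin_der_gram : trilin (fun X Y Z : gT => X (gram Y Z)).
Proof.
split=> [Y Z c X X'|X Z c Y Y'|X Y c Z Z'] //.
- by rewrite gram_linl derD derZ.
- by rewrite gram_linr derD derZ.
Qed.

Lemma trilin_torsion_form : trilin torsion_form.
Proof.
apply: trilinD.
  apply: trilinD; first exact: trilin_der_gram.
  exact/trilinN/(trilin13 trilin_der_gram).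
apply: trilinN; split=> [Y Z c X X'|X Z c Y Y'|X Y c Z Z'].
- by rewrite gbracket_linl gram_linr.
- exact: gram_linl.
- rewrite !(gbracketC X) gbracket_linl !gramNr gram_linr.
  by rewrite opprD scalerN.
Qed.

(* The six terms are the successive differences of a symbol around the hexagon
   of permutations of (X, Y, Z), so [d rho] is the obstruction to solving for
   the symbol. *)
Lemma dext_rhoE X Y Z :
  bracket_form X Y Z + torsion_form Y X Z
    + (bracket_form Z X Y + torsion_form X Z Y)
    + (bracket_form Y Z X + torsion_form Z Y X)
  = - dext (rho h) [tuple X; Y; Z].
Proof.
rewrite dext2E !rhoE /bracket_form /torsion_form !derD !derN.
rewrite (gbracketC Z X) !gramN !gramNr.
zmod.
Qed.

(* Below, [T X Y Z] plays the role of [(nabla_X (riesz (gstar Y))) Z];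
   [bracket_eq] is the image of the torsion equation [torsion_eq] under
   [metric_dual], whose fixed points are the metric symbols. *)
Definition bracket_eq (T : gT -> gT -> gT -> A) : Prop :=
  forall X Y Z, T X Y Z - T Y X Z = bracket_form X Y Z.

Definition torsion_eq (T : gT -> gT -> gT -> A) : Prop :=
  forall X Y Z, T X Y Z - T Z Y X = torsion_form X Y Z.

Definition metric_dual (T : gT -> gT -> gT -> A) (X Y Z : gT) : A :=
  X (gram Y Z) - star (T (gstar X) (gstar Z) (gstar Y)).

Lemma metric_dualK T X Y Z : metric_dual (metric_dual T) X Y Z = T X Y Z.
Proof.
rewrite /metric_dual starB starK star_der gram_star !gstarK.
zmod.
Qed.

Lemma metric_dual_bracket_eq T :
  torsion_eq T -> bracket_eq (metric_dual T).
Proof.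
move=> tT X Y Z; rewrite /metric_dual.
have := congr1 (@star _ _) (tT (gstar X) (gstar Z) (gstar Y)).
rewrite starB /torsion_form !starB !star_der !gram_star gstar_bracket !gstarK.
rewrite /bracket_form => E.
by apply: (eq_of_sub (esym E)); zmod.
Qed.

Lemma trilin_metric_dual T : trilin T -> trilin (metric_dual T).
Proof.
move=> lT; apply: trilinD; first exact: trilin_der_gram.
exact/trilinN/trilin_star.
Qed.

(* If d_1, ..., d_6 are the successive differences around the hexagon, the mean
   of T(X, Y, Z) - T(p(X, Y, Z)) over all permutations p is (5 d_1 + 4 d_2 +
   3 d_3 + 2 d_4 + d_5) / 6. *)
Definition averaged_torsion X Y Z : A :=
  (6 : C)^-1 *: (bracket_form X Y Z *+ 5 + torsion_form Y X Z *+ 4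
    + bracket_form Z X Y *+ 3 + torsion_form X Z Y *+ 2 + bracket_form Y Z X).

Lemma scale_natrK k (a : A) : (k.+1%:R : C)^-1 *: (a *+ k.+1) = a.
Proof. by rewrite -scaler_nat scalerA mulVf ?scale1r // pnatr_eq0. Qed.

Lemma trilin_averaged_torsion : trilin averaged_torsion.
Proof.
have lB := trilin_bracket_form; have lF := trilin_torsion_form.
apply: (trilinZ _ (trilinD (trilinD (trilinD (trilinD
  (trilinMn 5 lB) (trilinMn 4 (trilin12 lF))) (trilinMn 3 _))
  (trilinMn 2 _)) _)).
- by case: lB => *; split.
- by case: lF => *; split.
- by case: lB => *; split.
Qed.

(** * Solving the symbol equations when d rho = 0 *)

Section WeaklySymmetric.
Hypothesis ws : weakly_symmetric h.

Let hexagon X Y Z :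
  bracket_form X Y Z + torsion_form Y X Z
    + (bracket_form Z X Y + torsion_form X Z Y)
    + (bracket_form Y Z X + torsion_form Z Y X) = 0.
Proof. by rewrite dext_rhoE ws oppr0. Qed.

Lemma averaged_torsion_bracket_eq : bracket_eq averaged_torsion.
Proof.
move=> X Y Z; rewrite /averaged_torsion -scalerBr.
rewrite -[RHS](scale_natrK 5); congr (_ *: _).
rewrite (bracket_formC Y X) (torsion_formC X Y) (bracket_formC Z Y).
rewrite (torsion_formC Y Z) (bracket_formC X Z).
(* From (Y, X, Z) the hexagon is traversed backwards, with differences -d_1, -d_6, ..., -d_3. The
   numerators differ by 6 d_1 plus 4 times the vanishing sum. *)
by apply: (eq_of_sub (congr1 (fun a => a *+ 4) (hexagon X Y Z))); zmod.
Qed.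

Lemma averaged_torsion_torsion_eq : torsion_eq averaged_torsion.
Proof.
move=> X Y Z; rewrite /averaged_torsion -scalerBr.
rewrite -[RHS](scale_natrK 5); congr (_ *: _).
rewrite (torsion_formC X Y) (bracket_formC Z Y).
rewrite (torsion_formC Y Z) (bracket_formC X Z) (bracket_formC Y X).
rewrite (torsion_formC Z X).
(* From (Z, Y, X) the differences are -d_5, ..., -d_1. The numerators differ by 6 (d_1 + ... + d_5),
   which is -6 d_6 once the hexagon closes. *)
by apply: (eq_of_sub (congr1 (fun a => a *+ 6) (hexagon X Y Z))); zmod.
Qed.

Definition lc_symbol X Y Z : A :=
  (2 : C)^-1 *: (averaged_torsion X Y Z + metric_dual averaged_torsion X Y Z).

Lemma trilin_lc_symbol : trilin lc_symbol.
Proof.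
have lT := trilin_averaged_torsion.
exact: trilinZ (trilinD lT (trilin_metric_dual lT)).
Qed.

(** Both halves of the mean solve the equation: the second one because [averaged_torsion] solves the
    torsion equation. *)
Lemma lc_symbol_bracket_eq : bracket_eq lc_symbol.
Proof.
move=> X Y Z; rewrite /lc_symbol -scalerBr -[RHS](scale_natrK 1).
congr (_ *: _); rewrite mulr2n.
rewrite -{1}(averaged_torsion_bracket_eq X Y Z).
rewrite -(metric_dual_bracket_eq averaged_torsion_torsion_eq X Y Z).
zmod.
Qed.

(** An affine involution fixes the midpoint of each of its orbits. *)
Lemma lc_symbol_metric_dual X Y Z :
  metric_dual lc_symbol X Y Z = lc_symbol X Y Z.
Proof.
rewrite {1}/metric_dual /lc_symbol starZ fmorphV rmorph_nat starD.
rewrite -[X (gram Y Z) in LHS](scale_natrK 1) -scalerBr; congr (_ *: _).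
rewrite -[averaged_torsion X Y Z in RHS]metric_dualK.
rewrite /metric_dual; zmod.
Qed.

End WeaklySymmetric.

End Gram.

(** * Dual frames and the connection defined by a symbol *)

Section DualFrame.
Variables (C : numClosedFieldType) (A : starAlgType C).
Variable g : star_lie_subalg A.
Local Notation gT := (sla_elt g).
Variables (n : nat) (theta : 'I_n -> Omega1 g) (e : 'I_n -> gT).
Hypothesis e_basis : is_basis e.
Hypothesis dual : forall i a, theta i [tuple e a] = (i == a)%:R.

Definition extend (f : gT -> A) : Omega1 g := \sum_i f (e i) *: theta i.

(** Both sides are linear over [C] and agree on the basis [e] by duality; hence every [C]-linear map
    from g to A is a form in [Omega1 g]. *)
Lemma extendE f Y : clin f -> extend f [tuple Y] = f Y :> A.
Proof.
move=> lf; have [c ->] := e_basis.1 Y.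
rewrite (clin_sum _ lf) (clin_sum _ (@Omega1_lin _ _ _ (extend f))).
apply: eq_bigr => a _; rewrite (clinZ _ _ (Omega1_lin _)) (clinZ _ _ lf).
congr (_ *: _); rewrite -[LHS]/(phi (e a) (extend f)) linear_sum.
rewrite (bigD1 a) //= big1 ?addr0 => [|i /negPf ia].
  by rewrite -[LHS]/(f (e a) * theta a [tuple e a]) dual eqxx mulr1.
by rewrite -[LHS]/(f (e i) * theta i [tuple e a]) dual ia mulr0.
Qed.

Lemma extend_eval (w : Omega1 g) : extend (fun X => w [tuple X]) = w.
Proof. by apply: Omega1_ext => X; rewrite extendE //; exact: Omega1_lin. Qed.

(** Evaluating the dual frame shows that the coordinates satisfy y_a 1 = x_a z, so one nonzero x_a
    forces z to be a scalar. Linearity of a connection over the center thus reduces to linearity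
    over [C]. *)
Lemma zscale_scalar (z : A) (X Y : gT) : central z -> is_zscale z X Y ->
  X = 0 /\ Y = 0 \/ exists2 c : C, z = c%:A & Y = c *: X.
Proof.
move=> zc XY; have [x Xx] := e_basis.1 X; have [y Yy] := e_basis.1 Y.
have coordE (u : 'I_n -> C) W a : W = \sum_i u i *: e i ->
    theta a [tuple W] = (u a)%:A :> A.
  move=> ->.
  rewrite (clin_sum _ (@Omega1_lin _ _ _ (theta a))) (bigD1 a) //=.
  rewrite big1 ?addr0 => [|i /negPf ia].
    by rewrite (clinZ _ _ (Omega1_lin _)) dual eqxx.
  by rewrite (clinZ _ _ (Omega1_lin _)) dual eq_sym ia scaler0.
have {coordE} zxy a : y a *: 1 = x a *: z.
  have := Omega1Z (theta a) zc XY.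
  by rewrite (coordE _ _ a Xx) (coordE _ _ a Yy) mulr_algr.
have [x0|] := pselect (forall a, x a = 0).
  left; suff X0 : X = 0.
    by split=> //; apply: gt_ext => a; rewrite XY X0 mulr0.
  by rewrite Xx big1 // => i _; rewrite x0 scale0r.
move=> /existsNP[a /eqP xa]; right; exists ((x a)^-1 * y a).
  by rewrite -scalerA zxy scalerA mulVf // scale1r.
apply: gt_ext => b; rewrite XY -[RHS]/(((x a)^-1 * y a) *: X b).
by rewrite -[RHS]mulr_algl -scalerA zxy scalerA mulVf // scale1r.
Qed.

Variable h : hermitian_form (Omega1 g).
Hypothesis hi : invertible h.

(** Pairing any u = \sum_a u(e_a) theta^a with both sides gives the same value. This reduces metric
    compatibility to the forms [riesz h (e a)]. *)
Lemma riesz_span w : w = \sum_a h w (theta a) *: riesz h (e a).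
Proof.
apply: (hform_injr hi) => u; rewrite -[in LHS](extend_eval u).
rewrite (big_morph (h^~ w) (fun a b => hformDl h a b w) (hform0l h w)).
rewrite (big_morph (h u) (hformDr h u) (hform0r h u)).
by apply: eq_bigr => a _; rewrite hformZl hformZr rieszE // hform_star.
Qed.

Section Connection.
Variable T : gT -> gT -> gT -> A.
Hypothesis lT : trilin T.

(** Metric compatibility of [w] with E_Z, solved for (nabla_X w)(Z) after prescribing nabla_{X^*}
    E_Z = T(X^*, Z^*, -). *)
Definition conn_of_symbol (w : Omega1 g) (X : gT) : Omega1 g :=
  extend (fun Z =>
    X (w [tuple Z]) - h w (extend (T (gstar X) (gstar Z)))).

Lemma extendT_linl c X X' Y : extend (T (c *: X + X') Y)
  = c%:A *: extend (T X Y) + extend (T X' Y).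
Proof.
have [T1 T2 T3] := lT; apply: Omega1_ext => Z.
rewrite Omega1_addE Omega1_scaleE.
by rewrite !extendE // T1 mulr_algl.
Qed.

Lemma extendT_linr c X Y Y' : extend (T X (c *: Y + Y'))
  = c%:A *: extend (T X Y) + extend (T X Y').
Proof.
have [T1 T2 T3] := lT; apply: Omega1_ext => Z.
rewrite Omega1_addE Omega1_scaleE.
by rewrite !extendE // T2 mulr_algl.
Qed.

Lemma conn_of_symbolE w X Z : conn_of_symbol w X [tuple Z] =
  X (w [tuple Z]) - h w (extend (T (gstar X) (gstar Z))).
Proof.
apply: (extendE (f := fun Z => _)) => c Y Y'.
rewrite gstar_lin extendT_linr hformDr hformZr Omega1_lin derD derZ.
rewrite starZ star1 conjCK mulr_algr opprD scalerBr; zmod.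
Qed.

Lemma conn_of_symbol_linr w c X Y : conn_of_symbol w (c *: X + Y) =
  c%:A *: conn_of_symbol w X + conn_of_symbol w Y.
Proof.
apply: Omega1_ext => Z.
rewrite Omega1_addE Omega1_scaleE.
rewrite !conn_of_symbolE gstar_lin extendT_linl hformDr hformZr.
rewrite starZ star1 conjCK mulr_algr mulr_algl scalerBr der_lin; zmod.
Qed.

Lemma conn_of_symbol_connection : is_connection conn_of_symbol.
Proof.
have D w X Y :
    conn_of_symbol w (X + Y) = conn_of_symbol w X + conn_of_symbol w Y.
  by rewrite -[X in LHS]scale1r conn_of_symbol_linr !scale1r.
have Z0 w : conn_of_symbol w 0 = 0.
  by apply: (addrI (conn_of_symbol w 0)); rewrite -D !addr0.
split=> // [w v X|a w X|z X Y zc XY w].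
- apply: Omega1_ext => Z.
  rewrite Omega1_addE.
  rewrite !conn_of_symbolE hformDl.
  by rewrite Omega1_addE derD; zmod.
- apply: Omega1_ext => Z.
  rewrite Omega1_addE !Omega1_scaleE.
  rewrite !conn_of_symbolE hformZl.
  by rewrite derM mulrBr; zmod.
- have [[-> ->]|[c -> ->]] := zscale_scalar zc XY.
    by rewrite Z0 scaler0.
  by rewrite -[c *: X]addr0 conn_of_symbol_linr Z0 addr0.
Qed.

Hypothesis bT : bracket_eq h T.
Hypothesis mT : forall X Y Z, metric_dual h T X Y Z = T X Y Z.

Lemma conn_of_symbol_torsion_free : torsion_free conn_of_symbol.
Proof.
move=> w X Y; rewrite dext1E; have [T1 T2 T3] := lT.
rewrite !conn_of_symbolE.
suff E : extend (T (gstar X) (gstar Y)) =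
    extend (T (gstar Y) (gstar X)) + riesz h (gbracket X Y).
  by rewrite E hformDr rieszE //; zmod.
apply: Omega1_ext => Z.
rewrite Omega1_addE !extendE //; apply: (eq_of_sub (bT (gstar X) (gstar Y) Z)).
by rewrite /bracket_form /gram -gstar_bracket gstarK; zmod.
Qed.

(** Here [mT] enters: the connection has symbol [T] because its symbol is the metric dual of [T]. *)
Lemma conn_of_symbol_riesz X Y :
  conn_of_symbol (riesz h Y) X = extend (T X (gstar Y)).
Proof.
have [T1 T2 T3] := lT; apply: Omega1_ext => Z; rewrite extendE //.
rewrite conn_of_symbolE -mT /metric_dual /gram gstarK; congr (_ - _).
by rewrite -hform_star rieszE // extendE // gstarK.
Qed.

Lemma conn_of_symbol_compatible : compatible h conn_of_symbol.
Proof.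
have cc := conn_of_symbol_connection.
(* By additivity it suffices to treat one multiple of [riesz h (e a)], where the Leibniz rule and
   the defining formula of the connection give the claim. *)
move=> w eta X; rewrite [eta]riesz_span.
elim/big_ind: _ => [|v u Ev Eu|a _].
- rewrite hform0r der0.
  suff -> : conn_of_symbol 0 (gstar X) = 0 by rewrite !hform0r addr0.
  by apply: (addrI (conn_of_symbol 0 (gstar X))); rewrite -(connDl cc) !addr0.
- by rewrite (connDl cc) !hformDr derD Ev Eu addrACA.
- rewrite (connM cc) hformDr !hformZr derM conn_of_symbol_riesz !rieszE //.
  rewrite conn_of_symbolE mulrBl star_der gstarK; zmod.
Qed.

End Connection.

End DualFrame.

(** * The symbol of a given Levi-Civita connection *)

Section LeviCivitaSymbol.
Variables (C : numClosedFieldType) (A : starAlgType C).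
Variable g : star_lie_subalg A.
Variable h : hermitian_form (Omega1 g).
Hypothesis hi : invertible h.

Definition christoffel (nabla : Omega1 g -> sla_elt g -> Omega1 g) X Y Z : A :=
  nabla (riesz h (gstar Y)) X [tuple Z].

Variable nabla : Omega1 g -> sla_elt g -> Omega1 g.
Hypothesis lc : levi_civita h nabla.

Lemma christoffel_torsion_eq : torsion_eq h (christoffel nabla).
Proof.
have [_ tf _] := lc => X Y Z.
by have := tf (riesz h (gstar Y)) X Z; rewrite dext1E; exact.
Qed.

(** This is compatibility evaluated at E_{Y^*} and E_Z. *)
Lemma christoffel_metric_dual X Y Z :
  metric_dual h (christoffel nabla) X Y Z = christoffel nabla X Y Z.
Proof.
have [_ _ cp] := lc; have := cp (riesz h (gstar Y)) (riesz h Z) X.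
rewrite !rieszE // /metric_dual /gram => ->.
by rewrite /christoffel gstarK -hform_star !rieszE // addrK.
Qed.

Lemma christoffel_bracket_eq : bracket_eq h (christoffel nabla).
Proof.
move=> X Y Z.
rewrite -(christoffel_metric_dual X Y Z) -(christoffel_metric_dual Y X Z).
exact: (metric_dual_bracket_eq hi christoffel_torsion_eq).
Qed.

Lemma levi_civita_weakly_symmetric : weakly_symmetric h.
Proof.
apply: funext => t.
case/tupleP: t => X t; case/tupleP: t => Y t; case/tupleP: t => Z t.
have -> : [tuple of X :: [tuple of Y :: [tuple of Z :: t]]] = [tuple X; Y; Z].
  by apply: val_inj; rewrite /= (tuple0 t).
(* Written as differences of symbols, the six terms telescope around the hexagon. *)
apply: oppr_inj; rewrite -(dext_rhoE hi) -!christoffel_torsion_eq.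
rewrite -!christoffel_bracket_eq; transitivity (0 : A); first by zmod.
by rewrite oppr0.
Qed.

End LeviCivitaSymbol.

Theorem corollary7p8 (R : realType) (A : starAlgType R[i])
    (g : star_lie_subalg A) (h : hermitian_form (Omega1 g)) (n : nat)
    (hcalc : hermitian_calculus h)
    (dim_g : free_of_rank (sla_elt g) n)
    (rk_Omega1 : free_of_rank (Omega1 g) n)
    (dual_bases : exists (theta : 'I_n -> Omega1 g) (X : 'I_n -> sla_elt g),
      [/\ is_basis theta, is_basis X &
          forall i a, theta i [tuple X a] = (i == a)%:R]) :
  (exists nabla : Omega1 g -> sla_elt g -> Omega1 g, levi_civita h nabla)
  <-> weakly_symmetric h.
Proof.
have hi := hcalc.2; split=> [[nabla lc]|ws].
  exact: (levi_civita_weakly_symmetric hi lc).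
have [theta [e [_ e_basis dual]]] := dual_bases.
have lT := trilin_lc_symbol hi.
exists (conn_of_symbol theta e h (lc_symbol h)); split.
- exact: conn_of_symbol_connection.
- apply: conn_of_symbol_torsion_free => //.
  exact: lc_symbol_bracket_eq.
- apply: conn_of_symbol_compatible => //.
  exact: lc_symbol_metric_dual.
Qed.
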